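(* Let $\Lambda$ be a Gauss lattice in $\mathbb C^2$ and let $u,v$ be two consecutive minimal vectors of $\Lambda$. Then the sublattice $\mathbb Z[i]u+\mathbb Z[i]v$ has index $1$ or $2$ in $\Lambda$. Furthermore, when $\mathbb Z[i]u+\mathbb Z[i]v$ has index $2$, \[ \Lambda=\langle u,v\rangle_J:=\{gu+hv:(g,h)\in\mathbb Z[i]^2\cup J^2\}, \] where $J=\tfrac{1}{1+i}\mathbb Z[i]\setminus\mathbb Z[i]$.
   Context: A Gauss lattice in a finite-dimensional complex vector space $E$ is a $\mathbb Z[i]$-submodule of $E$ which is discrete and spans $E$ over $\mathbb C$. For $u=(u_1,u_2)\in\mathbb C^2$ let $C(u)=\{(z_1,z_2)\in\mathbb C^2:|z_1|\le|u_1|,\ |z_2|\le|u_2|\}$. A nonzero vector $u\in\Lambda$ is minimal if every nonzero $z\in\Lambda\cap C(u)$ satisfies $|z_1|=|u_1|$ and $|z_2|=|u_2|$. Two minimal vectors $u=(u_1,u_2)$, $v=(v_1,v_2)$ of $\Lambda$ are consecutive if $|u_2|<|v_2|$ and there is no minimal vector $w=(w_1,w_2)$ of $\Lambda$ with $|u_2|<|w_2|<|v_2|$. *)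

(* Defs.v *)
From HB Require Import structures.
From mathcomp Require Import all_boot all_order all_algebra complex.
From mathcomp Require Import all_classical all_reals all_analysis.
Import Order.TTheory GRing.Theory Num.Theory numFieldNormedType.Exports.
Set Implicit Arguments.
Unset Strict Implicit.
Unset Printing Implicit Defensive.
Local Open Scope classical_set_scope.
Local Open Scope ring_scope.

(* The notions below are stated over a [numClosedFieldType] so that the
   topology of ['rV[C]_n] is found by inference; they are meant for
   [C := R[i]] with [R : realType], i.e. the field of complex numbers. *)

Definition gauss_int (C : numClosedFieldType) : set C :=
  [set z | exists a b : int, z = a%:~R + 'i * b%:~R].

Definition gauss_submodule (C : numClosedFieldType) n
    (L : set 'rV[C]_n) : Prop :=
  [/\ L 0,
      forall x y, L x -> L y -> L (x + y)
    & forall g x, gauss_int g -> L x -> L (g *: x)].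

(* Discreteness of the subspace topology: all points of L are isolated. *)
Definition discrete_subset (C : numClosedFieldType) n
    (L : set 'rV[C]_n) : Prop :=
  L `<=` isolated L.

Definition spans_space (C : numClosedFieldType) n
    (L : set 'rV[C]_n) : Prop :=
  exists s : seq 'rV[C]_n, {in s, forall x, L x} /\ span s = fullv.

Definition gauss_lattice (C : numClosedFieldType) n
    (L : set 'rV[C]_n) : Prop :=
  [/\ gauss_submodule L, discrete_subset L & spans_space L].

(* The coordinates of u in C^2 are [u 0 0] and [u 0 1]. *)
Definition cylinder (C : numClosedFieldType) (u : 'rV[C]_2) : set 'rV[C]_2 :=
  [set z | `|z 0 0| <= `|u 0 0| /\ `|z 0 1| <= `|u 0 1|].

Definition minimal_vector (C : numClosedFieldType) (L : set 'rV[C]_2)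
    (u : 'rV[C]_2) : Prop :=
  [/\ L u, u != 0
    & forall z : 'rV[C]_2, z != 0 -> (L `&` cylinder u) z ->
        `|z 0 0| = `|u 0 0| /\ `|z 0 1| = `|u 0 1|].

Definition consecutive_minimal (C : numClosedFieldType) (L : set 'rV[C]_2)
    (u v : 'rV[C]_2) : Prop :=
  [/\ minimal_vector L u, minimal_vector L v, `|u 0 1| < `|v 0 1|
    & ~ exists w, minimal_vector L w /\ `|u 0 1| < `|w 0 1| < `|v 0 1|].

Definition combinations (C : numClosedFieldType) n (S : set (C * C))
    (u v : 'rV[C]_n) : set 'rV[C]_n :=
  [set gh.1 *: u + gh.2 *: v | gh in S].

Definition gauss_span (C : numClosedFieldType) n (u v : 'rV[C]_n) :
    set 'rV[C]_n :=
  combinations (@gauss_int C `*` @gauss_int C) u v.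

Definition J_set (C : numClosedFieldType) : set C :=
  [set g / (1 + 'i) | g in @gauss_int C] `\` @gauss_int C.

Definition J_span (C : numClosedFieldType) n (u v : 'rV[C]_n) :
    set 'rV[C]_n :=
  combinations ((@gauss_int C `*` @gauss_int C) `|` (@J_set C `*` @J_set C))
    u v.

Definition cosets (V : zmodType) (L M : set V) : set (set V) :=
  [set [set x + y | y in M] | x in L].

(* M is meant to be a subgroup of L. *)
Definition has_index (V : zmodType) (L M : set V) (k : nat) : Prop :=
  (cosets L M #= `I_k)%card.

(* Main.v *)
(* Write w in L as g u + h v with g, h complex.  Minimality of u and v leaves no
   nonzero lattice point with |z_1| < |u_1| and |z_2| < |v_2|, so the module Q
   of all coordinate pairs (g, h) contains no nonzero pair with |g| + |h| <= 1
   and |g|, |h| < 1.  Put r = 1 / sqrt 2.  Every complex g satisfies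
     d(g) + r d((1 + i) g) + (1 - r) d(2 g) <= 1,
   where d is the distance to suitable Gaussian integers: on the triangle with
   vertices 0, 1/2, (1 + i)/2 the left side is convex and equals 1 at each
   vertex.  The weights sum to 2, so adding the inequalities for g and h, the pair
   (g, h), (1 + i)(g, h) or 2(g, h) is within total distance 1 of a Gaussian
   pair, hence equals it.  Thus 2g and 2h are Gaussian, and a finite check
   leaves only Z[i]^2 and J^2. *)
Require Import Defs.
From mathcomp Require Import all_boot all_order all_algebra complex ring lra zify.
From mathcomp Require Import all_classical all_reals all_analysis.
Import Order.TTheory GRing.Theory Num.Theory numFieldNormedType.Exports.
Set Implicit Arguments.
Unset Strict Implicit.
Unset Printing Implicit Defensive.
Local Open Scope classical_set_scope.
Local Open Scope ring_scope.

(* [`|z|] lives in [R[i]], whose order is only partial; [modc] is the same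
   modulus with values in the totally ordered field [R]. *)
Definition modc (R : rcfType) (z : R[i]) : R := complex.Re `|z|.
Arguments modc {R} z : simpl never.

(** * The complex modulus with real values *)

Section Modulus.
Variable R : rcfType.
Implicit Types z w : R[i].

Lemma normr_modc z : `|z| = (modc z)%:C%C.
Proof. by case: z. Qed.

Lemma ler_modc z w : (`|z| <= `|w|) = (modc z <= modc w).
Proof. by rewrite !normr_modc lecR. Qed.

Lemma ltr_modc z w : (`|z| < `|w|) = (modc z < modc w).
Proof. by rewrite !normr_modc ltcR. Qed.

Lemma modc_ge0 z : 0 <= modc z.
Proof. by rewrite -ler0c -normr_modc. Qed.

Lemma modc_real (x : R) : modc x%:C%C = `|x|.
Proof. by rewrite /modc normc_def /= expr0n addr0 sqrtr_sqr. Qed.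

Lemma modc0 : modc (0 : R[i]) = 0.
Proof. by rewrite /modc normr0. Qed.

Lemma modc1 : modc (1 : R[i]) = 1.
Proof. by rewrite /modc normr1. Qed.

Lemma modc_eq0 z : (modc z == 0) = (z == 0).
Proof. by rewrite -(normr_eq0 z) normr_modc -(inj_eq (@complexI R)). Qed.

Lemma modcM z w : modc (z * w) = modc z * modc w.
Proof. by apply: (@complexI R); rewrite rmorphM -!normr_modc normrM. Qed.

Lemma modcV z : modc z^-1 = (modc z)^-1.
Proof. by apply: (@complexI R); rewrite fmorphV -!normr_modc normfV. Qed.

Lemma modcN z : modc (- z) = modc z.
Proof. by rewrite /modc normrN. Qed.

Lemma ler_modcD z w : modc (z + w) <= modc z + modc w.
Proof. by rewrite -lecR rmorphD -!normr_modc ler_normD. Qed.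

Lemma ler_modcB z w : modc (z - w) <= modc z + modc w.
Proof. by rewrite -(modcN w) ler_modcD. Qed.

Lemma modcMr (x : R) z : 0 <= x -> modc (x%:C%C * z) = x * modc z.
Proof. by move=> x0; rewrite modcM modc_real ger0_norm. Qed.

Lemma modc2 : modc (2 : R[i]) = 2.
Proof. by rewrite -(rmorph_nat (real_complex R) 2) modc_real ger0_norm. Qed.

Lemma modc_i : modc ('i : R[i]) = 1.
Proof. by rewrite /modc normCi. Qed.

Lemma modc_1i : modc (1 + 'i : R[i]) = Num.sqrt 2.
Proof. by rewrite /modc normc_def /= add0r addr0 expr1n. Qed.

Lemma rect_i z : z = (complex.Re z)%:C%C + 'i * (complex.Im z)%:C%C.
Proof. exact: complexE. Qed.

Lemma rect_i_inj (x y x' y' : R) :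
  x%:C%C + 'i * y%:C%C = x'%:C%C + 'i * y'%:C%C -> x = x' /\ y = y'.
Proof.
by rewrite -[x%:C%C + _]/(_ +i* _)%C -[x'%:C%C + _]/(_ +i* _)%C; simpc; case.
Qed.

End Modulus.

(** * Gaussian integers, their halves, and the set J *)

Section GaussInt.
Variable C : numClosedFieldType.
Implicit Types z w : C.

Lemma gauss_intz (a : int) : gauss_int (a%:~R : C).
Proof. by exists a, 0; rewrite mulr0 addr0. Qed.

Lemma gauss_int0 : gauss_int (0 : C).
Proof. exact: (gauss_intz 0). Qed.

Lemma gauss_int1 : gauss_int (1 : C).
Proof. exact: (gauss_intz 1). Qed.

Lemma gauss_inti : gauss_int ('i : C).
Proof. by exists 0, 1; rewrite mulr1 add0r. Qed.

Lemma gauss_intD z w : gauss_int z -> gauss_int w -> gauss_int (z + w).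
Proof.
move=> [a [b ->]] [c [d ->]]; exists (a + c), (b + d).
by rewrite !rmorphD /=; ring.
Qed.

Lemma gauss_intM z w : gauss_int z -> gauss_int w -> gauss_int (z * w).
Proof.
move=> [a [b ->]] [c [d ->]]; exists (a * c - b * d), (a * d + b * c).
have i2 := @sqrCi C.
rewrite !rmorphB !rmorphD !rmorphM /=; ring: i2.
Qed.

Lemma gauss_intN z : gauss_int z -> gauss_int (- z).
Proof. by rewrite -mulN1r; apply: gauss_intM; exact: (gauss_intz (-1)). Qed.

Lemma gauss_intB z w : gauss_int z -> gauss_int w -> gauss_int (z - w).
Proof. by move=> Gz Gw; apply: gauss_intD => //; apply: gauss_intN. Qed.

Lemma gauss_int_half z : gauss_int (2 * z) ->
  exists2 m : C, gauss_int m &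
    [\/ z = m, z = m + 1 / 2, z = m + 'i / 2 | z = m + (1 + 'i) / 2].
Proof.
move=> [a [b eqz]].
exists ((a %/ 2)%Z%:~R + 'i * (b %/ 2)%Z%:~R); first by eexists; eexists.
have {eqz} -> : z = (a%:~R + 'i * b%:~R) / 2 by rewrite -eqz; field.
have eqa : (a%:~R : C) = (a %/ 2)%Z%:~R * 2 + (a %% 2)%Z%:~R.
  by rewrite {1}(divz_eq a 2) rmorphD rmorphM.
have eqb : (b%:~R : C) = (b %/ 2)%Z%:~R * 2 + (b %% 2)%Z%:~R.
  by rewrite {1}(divz_eq b 2) rmorphD rmorphM.
rewrite eqa eqb.
have : (a %% 2)%Z = 0 \/ (a %% 2)%Z = 1 by lia.
have : (b %% 2)%Z = 0 \/ (b %% 2)%Z = 1 by lia.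
case=> -> [] ->;
  [apply: Or41|apply: Or42|apply: Or43|apply: Or44]; by field.
Qed.

End GaussInt.

Lemma half_not_gauss_int (R : rcfType) : ~ gauss_int ((1 + 'i) / 2 : R[i]).
Proof.
move=> [a [b e]].
have [] := @rect_i_inj R 1 1 (2 * a%:~R) (2 * b%:~R).
  rewrite !rmorphM /= !rmorph_int !rmorph_nat !rmorph1.
  have -> : 1 + 'i * 1 = 2 * ((1 + 'i) / 2) :> R[i] by field.
  by rewrite e; ring.
(* Comparing real parts leaves 1 = 2 a over the integers, impossible by parity. *)
move=> + _; rewrite -[2]/(2%:~R) -rmorphM /= -[1]/(1%:~R) => /eqP.
by rewrite eqr_int => /eqP; lia.
Qed.

(** Division by 1 + i, of norm 2, creates just one new class modulo Z[i], and i / (1 + i) = (1 + i)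
    / 2 represents it. So J is a single coset of Z[i]. *)
Lemma J_setP (R : rcfType) (z : R[i]) :
  J_set z <-> exists2 m : R[i], gauss_int m & z = m + (1 + 'i) / 2.
Proof.
have i2 := @sqrCi R[i].
have i1 : 1 + 'i != 0 :> R[i].
  by rewrite -modc_eq0 modc_1i sqrtr_eq0 -ltNge ltr0n.
split=> [[[g Gg <-] nG]|[m Gm ->]].
  have : gauss_int (2 * (g / (1 + 'i))).
    have -> : 2 * (g / (1 + 'i)) = (1 - 'i) * g by field: i2.
    apply: gauss_intM => //; apply: gauss_intB; [exact: gauss_int1|exact: gauss_inti].
  case/gauss_int_half => m Gm [] e.
  - by case: nG; rewrite e.
  (* Multiplication by 1 + i turns the residues 1/2 and i/2 into (1 + i)/2 and (1 + i)/2 - 1, which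
     are not Gaussian, whereas g is. *)
  - case: (@half_not_gauss_int R).
    have -> : (1 + 'i) / 2 = g - (1 + 'i) * m :> R[i].
      by rewrite -[g](divfK i1) e; ring.
    apply: gauss_intB => //; apply: gauss_intM => //.
    apply: gauss_intD; [exact: gauss_int1|exact: gauss_inti].
  - case: (@half_not_gauss_int R).
    have -> : (1 + 'i) / 2 = g - (1 + 'i) * m + 1 :> R[i].
      by rewrite -[g](divfK i1) e; field: i2.
    apply: gauss_intD; last exact: gauss_int1.
    apply: gauss_intB => //; apply: gauss_intM => //.
    apply: gauss_intD; [exact: gauss_int1|exact: gauss_inti].
  - by exists m.
split.
  exists ((1 + 'i) * m + 'i); last by field: i2.
  apply: gauss_intD; last exact: gauss_inti.
  apply: gauss_intM => //.
  apply: gauss_intD; [exact: gauss_int1|exact: gauss_inti].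
move=> G; apply: (@half_not_gauss_int R).
by rewrite -[X in gauss_int X](addKr m) addrC; apply: gauss_intB.
Qed.

Lemma J_setB (R : rcfType) (z w : R[i]) :
  J_set z -> J_set w -> gauss_int (z - w).
Proof.
move=> /J_setP[m Gm ->] /J_setP[n Gn ->].
by rewrite opprD addrACA subrr addr0; exact: gauss_intB.
Qed.

(** * Approximation by Gaussian integers *)

Section Approximation.
Variable R : realType.
Implicit Types z : R[i].
Local Notation r := (Num.sqrt 2 / 2 : R).

Lemma sqrt2_half_itv : [/\ 0 < r, r < 1, 1 <= 2 * r & r * Num.sqrt 2 = 1].
Proof.
have s0 : 0 < Num.sqrt 2 :> R by rewrite sqrtr_gt0.
have s2 : Num.sqrt 2 ^+ 2 = 2 :> R by rewrite sqr_sqrtr.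
split; nra.
Qed.

(* [a], [b], [c] are the barycentric coordinates of [z] in the triangle with
   vertices [0], [k], [m]. *)
Lemma approx_triangle (k m z : R[i]) (a b c : R) :
  modc k = r -> modc m <= 1 / 2 -> modc (m - k) <= 1 / 2 ->
  0 <= a -> 0 <= b -> 0 <= c -> a + b + c = 1 ->
  z = b%:C%C * k + c%:C%C * m ->
  modc z < 1 /\
  modc z + r * modc ((1 + 'i) * (z - k)) + (1 - r) * modc (2 * (z - m)) <= 1.
Proof.
have [r0 r1 r2 rs] := sqrt2_half_itv.
move=> nk nm nmk a0 b0 c0 abc ez.
have -> : modc ((1 + 'i) * (z - k)) = Num.sqrt 2 * modc (z - k).
  by rewrite modcM modc_1i.
have -> : modc (2 * (z - m)) = 2 * modc (z - m).
  by rewrite modcM modc2.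
(* [h0], [h1] and [h2] bound each modulus by its interpolation from the vertices. Combined with
   weights 1, 1 and 2 (1 - r), the bounds add up to a + b + c = 1. *)
have h0 : modc z <= b * r + c * (1 / 2).
  rewrite ez; apply: le_trans (ler_modcD _ _) _; rewrite !modcMr // nk.
  by rewrite lerD2l ler_wpM2l.
have h1 : modc (z - k) <= a * r + c * (1 / 2).
  have -> : z - k = c%:C%C * (m - k) - a%:C%C * k.
    have -> : a = 1 - b - c by lra.
    by rewrite ez !rmorphB rmorph1; ring.
  apply: le_trans (ler_modcB _ _) _; rewrite !modcMr // nk addrC.
  by rewrite lerD2l ler_wpM2l.
have h2 : modc (z - m) <= (a + b) * (1 / 2).
  have -> : z - m = - (b%:C%C * (m - k) + a%:C%C * m).
    have -> : a = 1 - b - c by lra.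
    by rewrite ez !rmorphB rmorph1; ring.
  rewrite modcN mulrDl addrC.
  apply: le_trans (ler_modcD _ _) _; rewrite !modcMr //.
  by rewrite lerD // ler_wpM2l.
have h2' := ler_wpM2l _ h2; have {h2'} := h2' (1 - r) ltac:(lra).
(* Since 1/2 <= r, these two signs turn [h0] into |z| <= r (a + b + c) = r < 1. *)
have : 0 <= a * r by nra.
have : 0 <= c * (2 * r - 1) by nra.
by rewrite (mulrA r) rs mul1r => ? ? ?; split; nra.
Qed.

(** The unit square around 0 splits into eight congruent triangles: the signs choose the quadrant,
    and comparing p with q chooses the half of it. Here k is a corner of the square and m the
    midpoint of a side. *)
Lemma approx_sign (s t : bool) (p q : R) (z : R[i]) :
  0 <= p <= 1 / 2 -> 0 <= q <= 1 / 2 ->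
  z = (-1) ^+ s * p%:C%C + 'i * ((-1) ^+ t * q%:C%C) ->
  exists k m : R[i], [/\ gauss_int ((1 + 'i) * k) & gauss_int (2 * m)] /\
    (modc z < 1 /\
     modc z + r * modc ((1 + 'i) * (z - k)) + (1 - r) * modc (2 * (z - m))
       <= 1).
Proof.
have i2 := @sqrCi R[i]; have [r0 r1 r2 rs] := sqrt2_half_itv.
set e : R[i] := (-1) ^+ s; set f : R[i] := (-1) ^+ t => p01 q01 ez.
have [Ge Gf] : gauss_int e /\ gauss_int f.
  by split; rewrite /e /f -(rmorph_sign intr); exact: gauss_intz.
have [ne nf] : modc e = 1 /\ modc f = 1.
  have n1 : modc (-1 : R[i]) = 1 by rewrite modcN modc1.
  by rewrite /e /f; case: (s); case: (t); rewrite ?expr0 ?expr1 ?n1 ?modc1.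
have n2 : modc (2^-1 : R[i]) = 1 / 2.
  by rewrite modcV modc2 div1r.
pose k := (e + 'i * f) / 2.
have [Gk nk1] : gauss_int ((1 + 'i) * k) /\ modc ((1 + 'i) * k) = 1.
  (* Multiplication by 1 + i rotates the corner k by an eighth of a turn and scales it to a unit: e
     for opposite signs, i f for equal ones. *)
  have : (1 + 'i) * k = e \/ (1 + 'i) * k = 'i * f.
    by rewrite /k /e /f; case: (s); case: (t);
      [right|left|left|right]; rewrite ?expr0 ?expr1; field: i2.
  have Gif : gauss_int ('i * f) by apply: gauss_intM => //; exact: gauss_inti.
  by case=> ->; split; rewrite ?modcM ?modc_i ?nf ?mul1r.
have nk : modc k = r.
  by move: nk1; rewrite modcM modc_1i => h; rewrite -[LHS]mul1r -{1}rs -mulrA h mulr1.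
have nif : modc ('i * f / 2) = 1 / 2.
  by rewrite !modcM n2 modc_i nf !mul1r.
have ne2 : modc (e / 2) = 1 / 2 by rewrite modcM n2 ne !mul1r.
have [qp|pq] := leP q p.
  exists k, (e / 2); split.
    by split=> //; rewrite mulrC divfK.
  apply: (@approx_triangle _ _ _ (1 - 2 * p) (2 * q) (2 * (p - q))) => //.
  - by rewrite ne2.
  - have -> : e / 2 - k = - ('i * f / 2) by rewrite /k; field.
    by rewrite modcN nif.
  - by lra.
  - by lra.
  - by lra.
  - by ring.
  - by rewrite ez /k !(rmorphM, rmorphB) !rmorph_nat /=; field.
exists k, ('i * f / 2); split.
  by split=> //; rewrite mulrC divfK //; apply: gauss_intM => //; exact: gauss_inti.
apply: (@approx_triangle _ _ _ (1 - 2 * q) (2 * p) (2 * (q - p))) => //.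
- by rewrite nif.
- have -> : 'i * f / 2 - k = - (e / 2) by rewrite /k; field.
  by rewrite modcN ne2.
- by lra.
- by lra.
- by lra.
- by ring.
- by rewrite ez /k !(rmorphM, rmorphB) !rmorph_nat /=; field.
Qed.

Lemma gauss_approx z : exists m0 m1 m2 : R[i],
  [/\ [/\ gauss_int m0, gauss_int m1 & gauss_int m2],
      modc (z - m0) < 1
    & modc (z - m0) + r * modc ((1 + 'i) * z - m1)
        + (1 - r) * modc (2 * z - m2) <= 1].
Proof.
have i2 := @sqrCi R[i].
(* Rounding each coordinate to a nearest integer brings z - m0 into the unit square around 0. *)
pose a := Num.floor (complex.Re z + 1 / 2).
pose b := Num.floor (complex.Im z + 1 / 2).
have /andP[] := floor_itv (complex.Re z + 1 / 2); rewrite -/a rmorphD /= => a1 a2.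
have /andP[] := floor_itv (complex.Im z + 1 / 2); rewrite -/b rmorphD /= => b1 b2.
pose x := complex.Re z - a%:~R; pose y := complex.Im z - b%:~R.
have G0 : gauss_int (a%:~R + 'i * b%:~R : R[i]) by exists a, b.
move: G0; set m0 := (X in gauss_int X) => G0.
have ez : z - m0 = x%:C%C + 'i * y%:C%C.
  by rewrite {1}[z]rect_i /m0 /x /y !rmorphB /= !rmorph_int; ring.
clearbody m0.
suff [k [m [[Gk Gm] [h1 h2]]]] : exists k m : R[i],
    [/\ gauss_int ((1 + 'i) * k) & gauss_int (2 * m)] /\
    (modc (z - m0) < 1 /\ modc (z - m0) + r * modc ((1 + 'i) * (z - m0 - k))
      + (1 - r) * modc (2 * (z - m0 - m)) <= 1).
  exists m0, ((1 + 'i) * m0 + (1 + 'i) * k), (2 * m0 + 2 * m); split => //.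
    split => //; apply: gauss_intD => //; apply: gauss_intM => //.
      by apply: gauss_intD; [exact: gauss_int1|exact: gauss_inti].
    exact: (@gauss_intz _ 2).
  have -> : (1 + 'i) * z - ((1 + 'i) * m0 + (1 + 'i) * k) =
      (1 + 'i) * (z - m0 - k) by ring.
  by have -> : 2 * z - (2 * m0 + 2 * m) = 2 * (z - m0 - m) by ring.
have x1 : - (1 / 2) <= x <= 1 / 2 by rewrite /x; lra.
have y1 : - (1 / 2) <= y <= 1 / 2 by rewrite /y; lra.
have sgE (w : R) : w%:C%C = (-1) ^+ (w < 0)%R * `|w|%:C%C :> R[i].
  by rewrite -(rmorph_sign (real_complex R)) -rmorphM -numEsign.
have nw (w : R) : - (1 / 2) <= w <= 1 / 2 -> 0 <= `|w| <= 1 / 2.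
  by rewrite normr_ge0 ler_norml.
apply: (@approx_sign (x < 0) (y < 0) _ _ _ (nw _ x1) (nw _ y1)).
by rewrite -!sgE.
Qed.
End Approximation.

(** * Modules between Z[i]^2 and C^2 without short vectors *)

Section GaussSubmodule.
Variable R : realType.
Implicit Types (z g h : R[i]) (Q : R[i] -> R[i] -> Prop).
Local Notation r := (Num.sqrt 2 / 2 : R).

(* The coordinate pairs [(g, h)] with [g u + h v] in the lattice; [inter_small]
   is what consecutiveness of [u] and [v] yields. *)
Record intermediate_submodule Q : Prop := IntermediateSubmodule {
  inter_gauss : forall g h, gauss_int g -> gauss_int h -> Q g h;
  interB : forall g h g' h', Q g h -> Q g' h' -> Q (g - g') (h - h');
  interZ : forall z g h, gauss_int z -> Q g h -> Q (z * g) (z * h);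
  inter_small : forall g h, Q g h -> modc g + modc h <= 1 ->
    modc g < 1 -> modc h < 1 -> g = 0 /\ h = 0 }.

Lemma intermediateC Q :
  intermediate_submodule Q -> intermediate_submodule (fun g h => Q h g).
Proof.
case=> QG QB QZ Qs; split; auto=> g h Qhg; rewrite addrC => *.
by have [] := Qs _ _ Qhg.
Qed.

Section Intermediate.
Variable Q : R[i] -> R[i] -> Prop.
Hypothesis HQ : intermediate_submodule Q.

Lemma inter_near g h m n : Q g h -> gauss_int m -> gauss_int n ->
  modc (g - m) + modc (h - n) <= 1 ->
  modc (g - m) < 1 -> modc (h - n) < 1 -> g = m /\ h = n.
Proof.
move=> Qgh Gm Gn s l1 l2.
have [] := inter_small HQ (interB HQ Qgh (inter_gauss HQ Gm Gn)) s l1 l2.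
by move=> /subr0_eq -> /subr0_eq ->.
Qed.

Lemma inter_double g h : Q g h -> gauss_int (2 * g) /\ gauss_int (2 * h).
Proof.
have [r0 r1 r2 rs] := @sqrt2_half_itv R.
have G2 : gauss_int (2 : R[i]) := @gauss_intz _ 2.
have G1i : gauss_int (1 + 'i : R[i]).
  by apply: gauss_intD; [exact: gauss_int1|exact: gauss_inti].
move=> Qgh.
have [m0 [m1 [m2 [[Gm0 Gm1 Gm2] lg sg]]]] := gauss_approx g.
have [n0 [n1 [n2 [[Gn0 Gn1 Gn2] lh sh]]]] := gauss_approx h.
have [s|s] := lerP (modc (g - m0) + modc (h - n0)) 1.
  have [-> ->] := inter_near Qgh Gm0 Gn0 s lg lh.
  by split; apply: gauss_intM.
have [t|t] := ltrP (modc ((1 + 'i) * g - m1) + modc ((1 + 'i) * h - n1)) 1.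
  have [] := inter_near (interZ HQ G1i Qgh) Gm1 Gn1 (ltW t).
  - by apply: le_lt_trans t; rewrite lerDl modc_ge0.
  - by apply: le_lt_trans t; rewrite lerDr modc_ge0.
  (* A Gaussian multiple by 1 + i suffices, because 1 + i divides 2. *)
  have e2 : 2 = (1 - 'i) * (1 + 'i) :> R[i] by have i2 := @sqrCi R[i]; ring: i2.
  have G1i' : gauss_int (1 - 'i : R[i]).
    by apply: gauss_intB; [exact: gauss_int1|exact: gauss_inti].
  by move=> eg eh; split; rewrite e2 -mulrA ?eg ?eh; apply: gauss_intM.
have [w|w] := ltrP (modc (2 * g - m2) + modc (2 * h - n2)) 1.
  have [] := inter_near (interZ HQ G2 Qgh) Gm2 Gn2 (ltW w).
  - by apply: le_lt_trans w; rewrite lerDl modc_ge0.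
  - by apply: le_lt_trans w; rewrite lerDr modc_ge0.
  by move=> -> ->.
(* All three distance sums are now at least 1, the first strictly. With weights 1, r, 1 - r they
   total more than 2, against [sg] and [sh]. *)
by nra.
Qed.

(** Such a pair would differ from (m, n) by a nonzero vector of total length r < 1. *)
Lemma inter_corner_gauss g h m n : Q g h -> gauss_int m -> gauss_int n ->
  g = m + (1 + 'i) / 2 -> h = n -> False.
Proof.
have [r0 r1 r2 rs] := @sqrt2_half_itv R.
move=> Qgh Gm Gn eg eh.
have nr : modc (g - m) = r.
  by rewrite eg addrAC subrr add0r modcM modc_1i modcV modc2.
have nh : modc (h - n) = 0 by rewrite eh subrr modc0.
have [||| egm _] := inter_near Qgh Gm Gn; rewrite ?nr ?nh ?addr0 ?ltr01 // ?ltW //.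
by move: nr; rewrite egm subrr modc0 => r00; move: r0; rewrite -r00 ltxx.
Qed.

End Intermediate.

(** Multiplication by 1 + i makes the corner g Gaussian and moves the residues 1/2 and i/2 of h to a
    corner. With the coordinates exchanged, this is the case of a corner paired with a Gaussian
    integer. *)
Lemma inter_corner Q g h m n : intermediate_submodule Q -> Q g h ->
  gauss_int m -> gauss_int n -> g = m + (1 + 'i) / 2 ->
  [\/ h = n, h = n + 1 / 2 | h = n + 'i / 2] -> False.
Proof.
have i2 := @sqrCi R[i].
have Gi := @gauss_inti R[i]; have G1 := @gauss_int1 R[i].
have G1i := gauss_intD G1 Gi.
move=> HQ Qgh Gm Gn eg [] eh.
- exact: (inter_corner_gauss HQ Qgh Gm Gn).
- have Q' := interZ HQ G1i Qgh.
  apply: (@inter_corner_gauss _ (intermediateC HQ) _ _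
            ((1 + 'i) * n) ((1 + 'i) * m + 'i) Q').
  + exact: gauss_intM.
  + by apply: gauss_intD => //; apply: gauss_intM.
  + by rewrite eh; field.
  + by rewrite eg; field: i2.
- have Q' := interZ HQ G1i Qgh.
  apply: (@inter_corner_gauss _ (intermediateC HQ) _ _
            ((1 + 'i) * n - 1) ((1 + 'i) * m + 'i) Q').
  + by apply: gauss_intB => //; apply: gauss_intM.
  + by apply: gauss_intD => //; apply: gauss_intM.
  + by rewrite eh; field: i2.
  + by rewrite eg; field: i2.
Qed.

Lemma inter_J_span Q g h : intermediate_submodule Q -> Q g h ->
  (gauss_int g /\ gauss_int h) \/ (J_set g /\ J_set h).
Proof.
move=> HQ Qgh; have HQC := intermediateC HQ.
have n2 : modc (2^-1 : R[i]) = 1 / 2.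
  by rewrite modcV modc2 div1r.
(* Residues other than the corner have modulus at most 1/2, so two of them have total length at most
   1 and must vanish. *)
have noncorner (z m : R[i]) :
    [\/ z = m, z = m + 1 / 2 | z = m + 'i / 2] -> modc (z - m) <= 1 / 2.
  case=> ->; first by rewrite subrr modc0 divr_ge0.
    by rewrite addrAC subrr add0r div1r n2.
  by rewrite addrAC subrr add0r modcM modc_i mul1r n2.
have [/gauss_int_half[m Gm eg] /gauss_int_half[n Gn eh]] := inter_double HQ Qgh.
have {}eg : [\/ g = m, g = m + 1 / 2 | g = m + 'i / 2] \/ g = m + (1 + 'i) / 2.
  by case: eg => ->; [left; apply: Or31|left; apply: Or32|left; apply: Or33|right].
have {}eh : [\/ h = n, h = n + 1 / 2 | h = n + 'i / 2] \/ h = n + (1 + 'i) / 2.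
  by case: eh => ->; [left; apply: Or31|left; apply: Or32|left; apply: Or33|right].
case: eg eh => eg [] eh.
- left; have := noncorner _ _ eg; have := noncorner _ _ eh => lh lg.
  by have [||| -> ->] := inter_near HQ Qgh Gm Gn; try lra.
- by case: (inter_corner HQC Qgh Gn Gm eh eg).
- by case: (inter_corner HQ Qgh Gm Gn eg eh).
- by right; split; apply/J_setP; [exists m|exists n].
Qed.
End GaussSubmodule.

(** * Finiteness of bounded parts of a lattice *)

Lemma finite_set_argmin (R : realDomainType) (T : choiceType) (f : T -> R)
    (A : set T) :
  finite_set A -> A !=set0 -> exists2 x, A x & forall y, A y -> f x <= f y.
Proof.
move=> /finite_seqP[s ->] [a sa]; pose i0 : seq_sub s := SeqSub sa.
case: (@arg_minP _ _ _ i0 xpredT (f \o val) isT) => i _ imin.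
exists (val i); first exact: (valP i).
by move=> y sy; exact: (imin (SeqSub sy) isT).
Qed.

Section Lattice.
Variables (R : realType) (n : nat).
Implicit Types (L : set 'rV[R[i]]_n).

Lemma discrete_subset_gap L : discrete_subset L -> L 0 ->
  exists2 e : R, 0 < e &
    forall z, L z -> (forall j, modc (z 0 j) < e) -> z = 0.
Proof.
move=> dL L0; have [_ [V]] := dL _ L0.
rewrite -nbhs_ballE => -[e /= e0 eV] VL.
(* The radius of the ball is an element of R[i]; being positive, it is real. *)
have ee : e = (complex.Re e)%:C%C by rewrite RRe_real // gtr0_real.
exists (complex.Re e); first by rewrite -ltcR -ee.
move=> z Lz ze; suff : (V `&` L) z by rewrite VL.
split=> //; apply: eV; split=> // i j.
rewrite !ord1 mxE -ball_normE /= sub0r normrN normr_modc ee ltcR.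
exact: ze.
Qed.

Lemma ler_modc_rect (z : R[i]) : modc z <= `|complex.Re z| + `|complex.Im z|.
Proof.
rewrite {1}[z]rect_i; apply: le_trans (ler_modcD _ _) _.
by rewrite modcM modc_i mul1r !modc_real.
Qed.

Lemma ler_Re_modc (z : R[i]) : `|complex.Re z| <= modc z.
Proof.
by rewrite -lecR -normr_modc normc_ge_Re.
Qed.

Lemma ler_Im_modc (z : R[i]) : `|complex.Im z| <= modc z.
Proof.
rewrite /modc normc_def /= -sqrtr_sqr ler_sqrt ?lerDr ?sqr_ge0//.
by rewrite addr_ge0 ?sqr_ge0.
Qed.

(** Points of [-B, B] in the same cell of a grid of step d are less than d apart. Shifting by B
    makes the quotients nonnegative, so that truncation is the floor. *)
Lemma trunc_grid (B d x y : R) : 0 < d -> `|x| <= B -> `|y| <= B ->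
  inord (Num.truncn ((x + B) / d)) = inord (Num.truncn ((y + B) / d))
    :> 'I_(Num.truncn (2 * B / d)).+1 -> `|x - y| < d.
Proof.
move=> d0; rewrite !ler_norml => /andP[x1 x2] /andP[y1 y2] /(congr1 val) /=.
(* [inord] preserves only indices within range, hence the upper bound. *)
have bnd (t : R) : - B <= t -> t <= B ->
    0 <= (t + B) / d /\ (Num.truncn ((t + B) / d) < (Num.truncn (2 * B / d)).+1)%N.
  move=> t1 t2; split; first by rewrite divr_ge0 ?(ltW d0) //; lra.
  by rewrite ltnS le_truncn // ler_pM2r ?invr_gt0 //; lra.
have [x0 xN] := bnd _ x1 x2; have [y0 yN] := bnd _ y1 y2.
rewrite !inordK // => exy.
have /andP[] := truncn_itv x0; have /andP[] := truncn_itv y0.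
rewrite exy -natr1 => a1 a2 b1 b2.
have : `|(x + B) / d - (y + B) / d| < 1 by rewrite ltr_norml; apply/andP; split; lra.
rewrite -mulrBl (_ : x + B - (y + B) = x - y); last by ring.
by rewrite normrM normfV (gtr0_norm d0) ltr_pdivrMr // mul1r.
Qed.

(** Pigeonhole: differences of lattice points are lattice points, so a fine enough grid has at most
    one of them in each cell. *)
Lemma discrete_gauss_finite L (B : R) : gauss_submodule L -> discrete_subset L ->
  finite_set [set z | L z /\ forall j, modc (z 0 j) <= B].
Proof.
move=> [L0 LD LZ] dL; have [e e0 eL] := discrete_subset_gap dL L0.
(* Real and imaginary parts each contribute less than e / 2 to a modulus that has to stay below the
   gap e. *)
pose d := e / 2; have d0 : 0 < d by rewrite divr_gt0.
pose N := Num.truncn (2 * B / d).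
pose f (z : 'rV[R[i]]_n) : {ffun 'I_n -> 'I_N.+1 * 'I_N.+1} :=
  [ffun j => (inord (Num.truncn ((complex.Re (z 0 j) + B) / d)),
              inord (Num.truncn ((complex.Im (z 0 j) + B) / d)))].
set A := [set z | _].
have f_inj : {in A &, injective f}.
  move=> z w /set_mem[Lz zB] /set_mem[Lw wB] /ffunP fzw.
  apply/subr0_eq/eL.
    by rewrite -scaleN1r; apply: LD => //; apply: LZ => //; apply: (gauss_intz _ (-1)).
  move=> j; have := fzw j; rewrite !ffunE => -[eRe eIm].
  rewrite !mxE; apply: le_lt_trans (ler_modc_rect _) _.
  have Rez := le_trans (ler_Re_modc _) (zB j).
  have Rew := le_trans (ler_Re_modc _) (wB j).
  have Imz := le_trans (ler_Im_modc _) (zB j).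
  have Imw := le_trans (ler_Im_modc _) (wB j).
  have := trunc_grid d0 Rez Rew eRe; have := trunc_grid d0 Imz Imw eIm.
  case: (z 0 j) (w 0 j) => a b [a' b'] /=; rewrite /d; lra.
rewrite -(eq_finite_set (inj_card_eq f_inj)).
exact: finite_finset.
Qed.

End Lattice.

(** * Consecutive minimal vectors *)

Section Consecutive.
Variables (R : realType) (L : set 'rV[R[i]]_2) (u v : 'rV[R[i]]_2).
Hypotheses (hL : gauss_lattice L) (huv : consecutive_minimal L u v).

Let Lsub : gauss_submodule L. Proof. by case: hL. Qed.

Lemma consecutive_lt1 : modc (u 0 1) < modc (v 0 1).
Proof. by case: huv => _ _; rewrite ltr_modc. Qed.

(** Otherwise u would lie in the cylinder of v, and minimality of v would force equal second
    moduli. *)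
Lemma consecutive_lt0 : modc (v 0 0) < modc (u 0 0).
Proof.
have := consecutive_lt1; case: huv => -[Lu u0 _] [_ _ vmin] _ _ uv1.
rewrite ltNge; apply/negP => uv0.
have [] := vmin u u0.
  by split=> //; split; rewrite ler_modc // ltW.
by move=> _ e; move: uv1; rewrite -ltr_modc e ltxx.
Qed.

(** A nonzero lattice point in this open region would yield, by taking one with least sum of moduli,
    a minimal vector strictly between u and v. *)
Lemma consecutive_gap z : L z ->
  modc (z 0 0) < modc (u 0 0) -> modc (z 0 1) < modc (v 0 1) -> z = 0.
Proof.
move=> Lz zu zv; apply: contrapT => /eqP z0.
pose A := [set w | [/\ L w, w != 0, modc (w 0 0) < modc (u 0 0)
                     & modc (w 0 1) < modc (v 0 1)]].
have finA : finite_set A.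
  have [_ dL _] := hL.
  apply: sub_finite_set
    (discrete_gauss_finite (modc (u 0 0) + modc (v 0 1)) Lsub dL).
  move=> w [Lw _ w0 w1]; split=> // j.
  have := modc_ge0 (u 0 0); have := modc_ge0 (v 0 1).
  case: j => [[|[|//]] jlt] *.
    by rewrite (_ : Ordinal jlt = 0); [lra|exact: val_inj].
  by rewrite (_ : Ordinal jlt = 1); [lra|exact: val_inj].
have [|w [Lw w0 wu wv] wmin] :=
  finite_set_argmin (fun w : 'rV[R[i]]_2 => modc (w 0 0) + modc (w 0 1)) finA.
  by exists z.
case: huv => -[Lu u0 umin] _ _ nw; apply: nw; exists w; split.
  split=> // x x0 [Lx []]; rewrite !ler_modc => xw0 xw1.
  (* A nonzero lattice point x in the cylinder of w is again in [A], so its sum of moduli cannot be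
     smaller. With both moduli at most those of w, they agree. *)
  have w_le : modc (w 0 0) + modc (w 0 1) <= modc (x 0 0) + modc (x 0 1).
    apply: wmin; by split=> //; [exact: le_lt_trans wu|exact: le_lt_trans wv].
  by rewrite !normr_modc; split; congr (_%:C%C); lra.
(* If |w_2| <= |u_2|, then w lies in the cylinder of u and minimality of u contradicts |w_1| <
   |u_1|. *)
rewrite !ltr_modc wv andbT ltNge; apply/negP => wu1.
have [] := umin w w0; first by split=> //; split; rewrite ler_modc // ltW.
by move=> e _; move: wu; rewrite -ltr_modc e ltxx.
Qed.

Let row2P (x y : 'rV[R[i]]_2) : x 0 0 = y 0 0 -> x 0 1 = y 0 1 -> x = y.
Proof.
move=> e0 e1; apply/rowP => -[[|[|//]] jlt].
  by rewrite (_ : Ordinal jlt = 0) //; exact: val_inj.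
by rewrite (_ : Ordinal jlt = 1) //; exact: val_inj.
Qed.

(** The two products differ already in modulus, as |v_1| < |u_1| and |u_2| < |v_2|. *)
Lemma consecutive_det : u 0 0 * v 0 1 - v 0 0 * u 0 1 != 0.
Proof.
rewrite subr_eq0; apply/eqP => /(congr1 (@modc R)); rewrite !modcM => e.
have := consecutive_lt0; have := consecutive_lt1.
have := modc_ge0 (v 0 0); have := modc_ge0 (u 0 1); nra.
Qed.

Lemma consecutive_coord w : exists g h, w = g *: u + h *: v.
Proof.
have D0 := consecutive_det.
exists ((w 0 0 * v 0 1 - v 0 0 * w 0 1) / (u 0 0 * v 0 1 - v 0 0 * u 0 1)),
       ((u 0 0 * w 0 1 - w 0 0 * u 0 1) / (u 0 0 * v 0 1 - v 0 0 * u 0 1)).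
by apply: row2P; rewrite !mxE; field.
Qed.

Lemma consecutive_free g h : g *: u + h *: v = 0 -> g = 0 /\ h = 0.
Proof.
have D0 := consecutive_det.
move=> e; have := congr1 (fun x : 'rV_2 => x 0 0) e.
have := congr1 (fun x : 'rV_2 => x 0 1) e; rewrite /= !mxE => e1 e0.
split; apply/eqP; rewrite -(mulIr_eq0 _ (mulIf D0)); apply/eqP.
  transitivity (v 0 1 * (g * u 0 0 + h * v 0 0) - v 0 0 * (g * u 0 1 + h * v 0 1)).
    by ring.
  by rewrite e0 e1 !mulr0 subr0.
transitivity (u 0 0 * (g * u 0 1 + h * v 0 1) - u 0 1 * (g * u 0 0 + h * v 0 0)).
  by ring.
by rewrite e0 e1 !mulr0 subr0.
Qed.

Lemma consecutive_inter : intermediate_submodule (fun g h => L (g *: u + h *: v)).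
Proof.
case: Lsub => L0 LD LZ; case: huv => -[Lu _ _] [Lv _ _] _ _.
have LB x y : L x -> L y -> L (x - y).
  move=> Lx Ly; rewrite -scaleN1r; apply: LD => //; apply: LZ => //.
  exact: (gauss_intz _ (-1)).
split=> [g h Gg Gh|g h g' h' Lgh Lgh'|z g h Gz Lgh|g h Lgh sgh g1 h1].
- by apply: LD; apply: LZ.
- by rewrite !scalerBl addrACA -opprD; apply: LB.
- by rewrite -!scalerA -scalerDr; apply: LZ.
(* In |g| |u_1| + |h| |v_1| the larger factor is |u_1|, so |g| + |h| <= 1 gives a value below |u_1|
   unless h = 0, where |g| < 1 is needed. The second coordinate is symmetric, with |h| < 1. *)
apply: consecutive_free; apply: consecutive_gap => //; rewrite !mxE;
  apply: le_lt_trans (ler_modcD _ _) _; rewrite !modcM.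
  have := consecutive_lt0; have := modc_ge0 g; have := modc_ge0 h.
  have := modc_ge0 (v 0 0); nra.
have := consecutive_lt1; have := modc_ge0 g; have := modc_ge0 h.
have := modc_ge0 (u 0 1); nra.
Qed.

End Consecutive.

(** * Index of a subgroup counted by cosets *)

Section Index.
Variables (V : zmodType) (M : set V).
Hypotheses (M0 : M 0) (MB : forall x y, M x -> M y -> M (x - y)).

Lemma coset_eqP x y : [set x + z | z in M] = [set y + z | z in M] <-> M (x - y).
Proof.
have MN z : M z -> M (- z) by rewrite -sub0r; apply: MB.
split=> [e|Mxy].
  have : [set x + z | z in M] x by exists 0; rewrite ?addr0.
  by rewrite e => -[z Mz <-]; rewrite addrAC subrr add0r.
apply/seteqP; split=> _ [z Mz <-].
  exists (x - y - - z); first by apply: MB => //; apply: MN.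
  by rewrite opprK addrA (addrCA y) subrr addr0.
exists (z - (x - y)); first exact: MB.
by rewrite opprB addrCA (addrCA x) subrr addr0 addrC.
Qed.

Lemma has_index1 : has_index M M 1.
Proof.
rewrite /has_index (_ : cosets M M = [set [set 0 + z | z in M]]).
  exact: card_set1.
apply/seteqP; split=> [_ [x Mx <-]|_ ->]; last by exists 0.
by apply/coset_eqP; rewrite subr0.
Qed.

Lemma has_index2 (L : set V) w : L 0 -> L w -> ~ M w ->
  (forall x, L x -> M x \/ M (x - w)) -> has_index L M 2.
Proof.
move=> L0 Lw nMw LM; apply/eq_cardSP.
(* Removing the trivial coset must leave exactly one, namely w + M. *)
exists [set 0 + z | z in M]; first by exists 0.
rewrite (_ : _ `\ _ = [set [set w + z | z in M]]); first exact: card_set1.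
apply/seteqP; split=> [_ [[x Lx <-]] /= nx0|_ ->].
  have [Mx|Mxw] := LM _ Lx; last exact/coset_eqP.
  by case: nx0; apply/coset_eqP; rewrite subr0.
split; first by exists w.
by move=> /= /coset_eqP; rewrite subr0.
Qed.

End Index.

(** * The Gaussian span inside the J-span *)

Section Span.
Variables (R : realType) (n : nat) (u v : 'rV[R[i]]_n).

Lemma gauss_span0 : gauss_span u v 0.
Proof.
by exists (0, 0); rewrite /= ?scale0r ?addr0 //; split; exact: gauss_int0.
Qed.

Lemma gauss_spanB x y :
  gauss_span u v x -> gauss_span u v y -> gauss_span u v (x - y).
Proof.
move=> [[g h] /= [Gg Gh] <-] [[g' h'] /= [Gg' Gh'] <-].
exists (g - g', h - h'); first by split; exact: gauss_intB.
by rewrite /= !scalerBl opprD addrACA.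
Qed.

Lemma J_spanB x y : J_span u v x -> J_span u v y ->
  ~ gauss_span u v x -> ~ gauss_span u v y -> gauss_span u v (x - y).
Proof.
move=> [[g h] /= [[Gg Gh] <-|[Jg Jh] <-]].
  by move=> _ []; exists (g, h).
move=> [[g' h'] /= [[Gg' Gh'] <-|[Jg' Jh'] <-]].
  by move=> _ []; exists (g', h').
move=> _ _; exists (g - g', h - h'); first by split; exact: J_setB.
by rewrite /= !scalerBl opprD addrACA.
Qed.

(** One non-Gaussian element x together with the Gaussian span recovers the whole J-span; this gives
    the inclusion of the J-span in the lattice. *)
Lemma J_span_gaussD x y : J_span u v x -> ~ gauss_span u v x ->
  J_span u v y -> exists2 z, gauss_span u v z & y = z \/ y = x + z.
Proof.
move=> Jx nGx Jy; have [Gy|nGy] := pselect (gauss_span u v y).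
  by exists y => //; left.
by exists (y - x); [exact: J_spanB|right; rewrite addrC subrK].
Qed.

End Span.

Theorem theorem1 (R : realType) (L : set 'rV[R[i]]_2) (u v : 'rV[R[i]]_2)
    (hL : gauss_lattice L) (huv : consecutive_minimal L u v) :
  (has_index L (gauss_span u v) 1 \/ has_index L (gauss_span u v) 2) /\
  (has_index L (gauss_span u v) 2 -> L = J_span u v).
Proof.
have [L0 LD LZ] : gauss_submodule L by case: hL.
have [Lu Lv] : L u /\ L v by case: huv => -[Lu _ _] [Lv _ _] _ _.
have GL : gauss_span u v `<=` L.
  by move=> _ [[g h] [Gg Gh] <-]; apply: LD; apply: LZ.
have LJ : L `<=` J_span u v.
  move=> w; have [g [h ->]] := consecutive_coord huv w => Lgh.
  exists (g, h) => //.
  by have [] := inter_J_span (consecutive_inter hL huv) Lgh; [left|right].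
have G0 := gauss_span0 u v; have GB := @gauss_spanB _ _ u v.
have [LG|[w [Lw nGw]]] :
    L `<=` gauss_span u v \/ exists w, L w /\ ~ gauss_span u v w.
  have [|/existsNP[w /not_implyP]] := pselect (L `<=` gauss_span u v); first by left.
  by right; exists w.
  have -> : L = gauss_span u v by apply/seteqP.
  have i1 := has_index1 G0 GB; split; first by left.
  (* Here the index is 1, so index 2 is absurd and the second claim is vacuous. *)
  move=> i2; have : (`I_1 #= `I_2)%card by rewrite -(card_eql i1).
  by move/card_eq_II.
split.
  right; apply: (has_index2 G0 GB L0 Lw nGw) => x Lx.
  have [Gx|nGx] := pselect (gauss_span u v x); first by left.
  by right; apply: J_spanB => //; exact: LJ.
move=> _; apply/seteqP; split=> // y /(J_span_gaussD (LJ _ Lw) nGw).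
by case=> z Gz [] ->; [|apply: LD => //]; exact: GL.
Qed.
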